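(* Fix an integer $m\geq3$. There exists $N$ (depending on $m$) such that for every finite group $G$ of order $n\geq N$, the proportion of skew set-matrices $\mathcal{S}$ of $G$ such that $m\text{-}\mathrm{Cay}(G,\mathcal{S})$ is an $m$-PGSR of $G$ is greater than $1-m^2/\sqrt{n}$.
   Context: A set-matrix of a group $G$ is an $m\times m$ matrix $\mathcal{S}=(S_{i,j})$ whose entries are subsets of $G$. The $m$-Cayley digraph $m\text{-}\mathrm{Cay}(G,\mathcal{S})$ has vertex set $G\times\{1,\ldots,m\}$ and arc set $\{((g,i),(sg,j)) : i,j\in\{1,\ldots,m\},\ s\in S_{i,j},\ g\in G\}$. $\mathcal{S}$ is skew if $S_{j,i}=S_{i,j}^{-1}$ for all $i,j$ and $S_{i,i}=\emptyset$ for all $i$; then $m\text{-}\mathrm{Cay}(G,\mathcal{S})$ is an undirected $m$-partite graph with parts $G\times\{i\}$. It is an $m$-PGSR ($m$-partite graphical semiregular representation) of $G$ if its automorphism group is isomorphic to $G$. The proportion is taken among all skew set-matrices of $G$. *)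

(* Defs.v *)
From HB Require Import structures.
From mathcomp Require Import all_boot all_order all_algebra all_fingroup.

Set Implicit Arguments.
Unset Strict Implicit.
Unset Printing Implicit Defensive.

Import GroupScope.

Section GraphAut.
Variables (V : finType) (e : rel V).

Definition graph_aut : {set {perm V}} :=
  [set p : {perm V} | [forall x, forall y, e (p x) (p y) == e x y]].

Lemma graph_aut_group_set : group_set graph_aut.
Proof.
apply/group_setP; split.
  by rewrite inE; apply/'forall_forallP => x y; rewrite !perm1.
move=> p q; rewrite !inE => /'forall_'forall_eqP Hp /'forall_'forall_eqP Hq.
by apply/'forall_'forall_eqP => x y; rewrite !permM Hq Hp.
Qed.
Canonical graph_aut_group := Group graph_aut_group_set.

End GraphAut.

Section MCayley.
Variables (gT : finGroupType) (m : nat).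
Implicit Type S : 'M[{set gT}]_m.

Definition mCay S : rel (gT * 'I_m) :=
  [rel x y | [exists s in S x.2 y.2, y.1 == s * x.1]].

(* The inverse of a set is the pointwise one, {s^-1 | s in S_(i,j)}. *)
Definition skew_setmx S : bool :=
  [forall i, forall j, S j i == (S i j)^-1] && [forall i, S i i == set0].

Definition is_mPGSR S : bool := graph_aut (mCay S) \isog [set: gT].

Definition skew_matrices : {set 'M[{set gT}]_m} :=
  [set S : 'M[{set gT}]_m | skew_setmx S].

Definition mPGSR_matrices : {set 'M[{set gT}]_m} :=
  [set S in skew_matrices | is_mPGSR S].

End MCayley.

Arguments skew_matrices gT m : clear implicits.
Arguments mPGSR_matrices gT m : clear implicits.

Definition mPGSR_proportion (R : rcfType) (gT : finGroupType) (m : nat) : R :=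
  (#|mPGSR_matrices gT m|%:R / #|skew_matrices gT m|%:R)%R.
Arguments mPGSR_proportion R gT m : clear implicits.

(* Main.v *)
Require Import Defs.
From HB Require Import structures.
From mathcomp Require Import all_boot all_order all_algebra all_fingroup.
From mathcomp Require Import zify ring.
Import Order.TTheory GRing.Theory Num.Theory.

Set Implicit Arguments.
Unset Strict Implicit.
Unset Printing Implicit Defensive.

(** Let n = |G| and call G x {i} the parts. The right translations are always
    automorphisms, so it suffices to show that there is no other automorphism,
    outside a proportion O(m^3 / n) of the skew set-matrices.

    1. The agreement of x and y is the sum over z of the signs
    (-1)^(e(x,z) + e(y,z)), where e is adjacency. It is n plus noise if x and y
    lie in the same part, and noise otherwise, and the noise has second moment
    O(mn). By Chebyshev, outside a proportion O(m^3 / n), all but n/4 vertices y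
    agree with x as expected, whatever x is; the automorphisms then preserve
    "being in the same part".

    2. Fix k = O(log n) elements v_l of G. Up to a proportion m^2 / n, for all
    i <> j the vertices of part j are separated by their adjacencies to the
    (v_l, i). The restriction of an automorphism f to part j is then determined
    by the images of the (v_l, i) and by the entries of the matrix at (i, j) and
    (f(i), f(j)). There are only (mn)^k = 2^O(log^2 n) possible images, so a
    union bound over them is affordable.

    3. If f carries part j to a part b <> j, take i distinct from j and b. The
    entry (i, j) is determined by the other entries and the images of the
    (v_l, b) and (1, i), so the proportion is at most (mn)^O(k) / 2^n.

    4. If f fixes all parts, take distinct parts b, i, j. The images of the
    (v_l, b) determine f on the parts i and j, say as f1 and f2, and the entry
    (i, j) is invariant under all the moves s -> f2(sg) f1(g)^-1. The elements
    fixed by all these moves form a coset of a subgroup or the empty set, so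
    either f is a translation or at least n/2 elements are moved, and the
    proportion is at most (mn)^k / 2^(n/4). *)

(** * Counting *)

Lemma leq_card_setU4 (T : finType) (A B C D : {set T}) :
  #|A :|: B :|: C :|: D| <= #|A| + #|B| + #|C| + #|D|.
Proof.
do 2!(apply: leq_trans (leq_card_setU _ _) _; rewrite leq_add2r).
exact: leq_card_setU.
Qed.

Lemma leq_card_bigcup (T I : finType) (P : pred I) (F : I -> {set T}) :
  #|\bigcup_(i | P i) F i| <= \sum_(i | P i) #|F i|.
Proof.
elim/big_ind2: _ => [|A a B b leA leB|//]; first by rewrite cards0.
by apply: leq_trans (leq_card_setU _ _) (leq_add leA leB).
Qed.

Lemma union_bound (T I : finType) (P : pred I) (F : I -> {set T}) (X : {set T}) c C :
  X \subset \bigcup_(i | P i) F i -> (forall i, P i -> #|F i| * c <= C) ->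
  #|X| * c <= #|I| * C.
Proof.
move=> /subset_leq_card/leq_trans/(_ (leq_card_bigcup P F)) leX leF.
apply: leq_trans (leq_mul leX (leqnn c)) _.
rewrite big_distrl -sum_nat_const big_mkcond /=; apply: leq_sum => i _.
by case: ifP => // /leF.
Qed.

Lemma markov_card (T : finType) (A : {pred T}) (f : T -> nat) c :
  #|[set a in A | c <= f a]| * c <= \sum_(a in A) f a.
Proof.
rewrite -sum_nat_const big_mkcond [leqRHS]big_mkcond; apply: leq_sum => a _.
by rewrite inE; case: (a \in A) => //=; case: ifP.
Qed.

Lemma leq_ratio_trans a c C n D K :
  0 < c -> a * c <= C * K -> C * n <= D * c -> a * n <= D * K.
Proof.
move=> c_gt0 le_ac le_Cn; rewrite -(leq_pmul2r c_gt0) mulnAC.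
apply: leq_trans (leq_mul le_ac (leqnn n)) _.
by rewrite mulnAC [leqRHS]mulnAC leq_mul2r le_Cn orbT.
Qed.

Lemma exists_neq2 (T : finType) (a b : T) : 2 < #|T| -> exists2 c, c != a & c != b.
Proof.
move=> T_gt2; have /subsetPn[c _] : ~~ ([set: T] \subset [set a; b]).
  apply: contraL T_gt2 => /subset_leq_card; rewrite cardsT -leqNgt => /leq_trans.
  by apply; rewrite cards2; case: (a == b).
by rewrite !inE negb_or => /andP[]; exists c.
Qed.

Definition toggle (T : finType) (s : T) (A : {set T}) : {set T} :=
  [set x | (x \in A) (+) (x == s)].

Lemma toggleK (T : finType) (s : T) : involutive (toggle s).
Proof. by move=> A; apply/setP => x; rewrite !inE -addbA addbb addbF. Qed.

Section Inseparable.
Variables (T : finType) (X : {set {set T}}).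

Definition inseparable (s t : T) : bool := [forall A in X, (s \in A) == (t \in A)].

(* A set of X is determined by its trace outside M, by induction on the rank. *)
Lemma card_inseparable_rank (r : T -> nat) (M : {set T}) :
  (forall s, s \in M -> exists2 t, r t < r s & inseparable s t) ->
  #|X| * 2 ^ #|M| <= 2 ^ #|T|.
Proof.
move=> lowerM.
have injD : {in X &, injective (fun A => A :\: M)}.
  move=> A B XA XB eqAB; apply/setP => s.
  have [d] := ubnP (r s); elim: d => // d IHd in s *; rewrite ltnS => le_rs.
  have [/lowerM[t lt_ts /forall_inP ins]|notMs] := boolP (s \in M).
    by rewrite (eqP (ins A XA)) (eqP (ins B XB)) IHd ?(leq_trans lt_ts).
  by move/setP/(_ s): eqAB; rewrite !inE notMs.
rewrite -[#|T|](cardsC M) mulnC expnD leq_mul2l -(card_powerset (~: M)).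
rewrite -(card_in_imset injD); apply/orP; right; apply/subset_leq_card/subsetP.
by move=> _ /imsetP[A _ ->]; rewrite inE subDset setUCr subsetT.
Qed.

(* Rank the points along an enumeration of T, or along the reverse one: for one
   of the two, at least half of the points of M have a partner of lower rank. *)
Lemma card_inseparable (M : {set T}) :
  (forall s, s \in M -> exists2 t, t != s & inseparable s t) ->
  #|X| * 2 ^ uphalf #|M| <= 2 ^ #|T|.
Proof.
move=> partnerM; pose low (r : T -> nat) :=
  [set s in M | [exists t, (r t < r s) && inseparable s t]].
have card_low r : #|X| * 2 ^ #|low r| <= 2 ^ #|T|.
  apply: (@card_inseparable_rank r) => s.
  by rewrite inE => /andP[_ /existsP[t /andP[]]]; exists t.
pose up (s : T) : nat := enum_rank s; pose down (s : T) : nat := rev_ord (enum_rank s).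
have : M \subset low up :|: low down.
  apply/subsetP => s Ms; rewrite !inE Ms /=; have [t neq_ts ins] := partnerM s Ms.
  rewrite -(inj_eq enum_rank_inj) -val_eqE neq_ltn in neq_ts.
  case/orP: neq_ts => lt_ts; apply/orP; [left | right].
    by apply/existsP; exists t; rewrite lt_ts.
  apply/existsP; exists t; rewrite ins andbT ltn_sub2l //.
  exact: leq_ltn_trans lt_ts (ltn_ord _).
move=> /subset_leq_card/leq_trans/(_ (leq_card_setU _ _)) leM.
have [le_low|/ltnW le_low] := leqP #|low up| #|low down|.
  apply: leq_trans (card_low down); rewrite leq_mul2l leq_pexp2l ?orbT //.
  by rewrite leq_uphalf_double; lia.
apply: leq_trans (card_low up); rewrite leq_mul2l leq_pexp2l ?orbT //.
by rewrite leq_uphalf_double; lia.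
Qed.

End Inseparable.

Import GroupScope.

(** * Skew set-matrices *)

Section SkewMatrices.
Variables (gT : finGroupType) (m : nat).
Implicit Type (S : 'M[{set gT}]_m) (A : {set gT}) (i j k l : 'I_m).
Implicit Type (x y z : gT * 'I_m).
Local Notation n := #|gT|.
Local Notation skew := (skew_matrices gT m).

Lemma card_vertex : #|{: gT * 'I_m}| = (n * m)%N.
Proof. by rewrite card_prod card_ord. Qed.

Lemma mCayE S x y : mCay S x y = (y.1 * x.1^-1 \in S x.2 y.2).
Proof.
apply/existsP/idP => [[s /andP[sS /eqP ->]]|xyS]; first by rewrite mulgK.
by exists (y.1 * x.1^-1); rewrite xyS mulgKV eqxx.
Qed.

Lemma skewP S :
  reflect ((forall i j, S j i = (S i j)^-1) /\ (forall i, S i i = set0)) (S \in skew).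
Proof.
rewrite inE; apply: (iffP andP) => [[/'forall_'forall_eqP SV /'forall_eqP S0]|[SV S0]].
  by split.
by split; [apply/'forall_'forall_eqP | apply/'forall_eqP].
Qed.

Lemma card_skew_gt0 : (0 < #|skew|)%N.
Proof.
apply/card_gt0P; exists (const_mx set0); apply/skewP.
by split=> [i j|i]; rewrite !mxE //; apply/setP => s; rewrite mem_invg !inE.
Qed.

Lemma mCay_sym S : S \in skew -> symmetric (mCay S).
Proof. by case/skewP=> SV _ x y; rewrite !mCayE (SV y.2) mem_invg invMg invgK. Qed.

Lemma mCay_same_part S x y : S \in skew -> x.2 = y.2 -> mCay S x y = false.
Proof. by case/skewP => _ S0 exy; rewrite mCayE exy S0 inE. Qed.

Lemma mCay_eq_row S S' i x y : S \in skew -> S' \in skew -> S i =1 S' i ->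
  (x.2 == i) || (y.2 == i) -> mCay S x y = mCay S' x y.
Proof.
move=> skS skS' eqi; have row u w : u.2 = i -> mCay S u w = mCay S' u w.
  by move=> ui; rewrite !mCayE ui eqi.
by case/orP=> /eqP; last rewrite (mCay_sym skS) (mCay_sym skS'); apply: row.
Qed.

Definition upd_skew S i j A : 'M[{set gT}]_m :=
  \matrix_(k, l) if (k == i) && (l == j) then A
                 else if (k == j) && (l == i) then A^-1 else S k l.

Lemma upd_skewE S i j A : upd_skew S i j A i j = A.
Proof. by rewrite mxE !eqxx. Qed.

Lemma upd_skew_row S i j A k : k != i -> k != j -> upd_skew S i j A k =1 S k.
Proof. by move=> /negPf nki /negPf nkj l; rewrite mxE nki nkj. Qed.

Lemma upd_skew_in S i j A : i != j -> S \in skew -> upd_skew S i j A \in skew.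
Proof.
move=> nij /skewP[SV S0]; apply/skewP; split=> [k l|k]; rewrite !mxE.
  rewrite [(l == i) && _]andbC [(l == j) && _]andbC SV.
  have [->|_] := eqVneq k i; first by rewrite /= (negPf nij) /=; case: (l == j).
  by case: (k == j); case: (l == i); rewrite ?invgK.
by have [->|_] := eqVneq k i; rewrite ?(negPf nij) ?andbF ?S0.
Qed.

Lemma upd_skewK S i j A :
  i != j -> S \in skew -> upd_skew (upd_skew S i j A) i j (S i j) = S.
Proof.
move=> nij /skewP[SV _]; apply/matrixP => k l; rewrite !mxE.
case: ifP => [/andP[/eqP-> /eqP->] //|->].
by case: ifP => [/andP[/eqP-> /eqP->]|-> //]; rewrite -SV.
Qed.

Lemma sum_upd_skew (F : 'M[{set gT}]_m -> nat) i j : i != j ->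
  (\sum_(S in skew) \sum_A F (upd_skew S i j A) = 2 ^ n * \sum_(S in skew) F S)%N.
Proof.
move=> nij.
pose swap (SA : 'M[{set gT}]_m * {set gT}) := (upd_skew SA.1 i j SA.2, SA.1 i j).
have swapK SA : SA.1 \in skew -> swap (swap SA) = SA.
  by case: SA => S A skS; rewrite /swap /= upd_skewE upd_skewK.
rewrite pair_big_dep /= (reindex_onto swap swap); last by move=> SA /andP[/swapK].
have -> : (2 ^ n * \sum_(S in skew) F S = \sum_(S in skew) \sum_(A : {set gT}) F S)%N.
  rewrite big_distrr; apply: eq_bigr => S _; rewrite sum_nat_const.
  by rewrite -[#|{set gT}|]cardsT -powersetT card_powerset cardsT.
rewrite pair_big_dep; apply: eq_big => [SA|SA /andP[_ /eqP /(congr1 fst) /= -> //]].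
rewrite !andbT; apply/andP/idP => [[skSA /eqP <-]|skSA]; first exact: upd_skew_in.
by rewrite swapK // upd_skew_in.
Qed.

Lemma leq_card_fibers (X : {set 'M[{set gT}]_m}) i j c : i != j -> X \subset skew ->
  (forall S, S \in skew -> #|[set A | upd_skew S i j A \in X]| * c <= 2 ^ n)%N ->
  (#|X| * c <= #|skew|)%N.
Proof.
move=> nij /setIidPr skX fib; rewrite -(leq_pmul2l (_ : 0 < 2 ^ n)%N) ?expn_gt0 //.
have -> : #|X| = (\sum_(S in skew) (S \in X))%N.
  rewrite -[in LHS]skX -sum1dep_card big_mkcondr.
  by apply: eq_bigr => S _; case: (S \in X).
rewrite mulnA -(sum_upd_skew (fun S => S \in X) nij) big_distrl.
rewrite [leqRHS]mulnC -sum_nat_const.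
apply: leq_sum => S /fib; congr (_ * _ <= _)%N.
by rewrite -sum1dep_card big_mkcond; apply: eq_bigr => A _; case: (_ \in X).
Qed.

Lemma graph_autP S (f : {perm gT * 'I_m}) :
  reflect (forall x y, mCay S (f x) (f y) = mCay S x y) (f \in graph_aut (mCay S)).
Proof. by rewrite inE; apply: 'forall_'forall_eqP. Qed.

Lemma right_mul_inj (h : gT) : injective (fun x : gT * 'I_m => (x.1 * h, x.2)).
Proof. by move=> [a i] [b j] /= [/mulIg -> ->]. Qed.

Definition rtrans (h : gT) : {perm gT * 'I_m} := perm (@right_mul_inj h).

Lemma rtransE h x : rtrans h x = (x.1 * h, x.2).
Proof. by rewrite permE. Qed.

Lemma rtransM : {morph rtrans : h k / h * k}.
Proof. by move=> h k; apply/permP => x; rewrite permM !rtransE /= mulgA. Qed.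

Lemma rtrans_aut S h : rtrans h \in graph_aut (mCay S).
Proof. by apply/graph_autP => x y; rewrite !mCayE !rtransE /= invMg mulgA mulgK. Qed.

Lemma is_mPGSR_rtrans S : (0 < m)%N ->
  {in graph_aut (mCay S), forall f, exists h, f = rtrans h} -> is_mPGSR S.
Proof.
move=> m_gt0 autT; pose rho := Morphism (D := [set: gT]) (in2W rtransM).
rewrite /is_mPGSR isog_sym; apply/isogP; exists rho.
  apply/injmP => h k _ _ /permP/(_ (1, Ordinal m_gt0)).
  by rewrite !rtransE !mul1g => -[].
apply/setP => f; apply/morphimP/idP => [[h _ _ ->]|/autT[h ->]]; first exact: rtrans_aut.
by exists h; rewrite ?inE.
Qed.

Lemma not_mPGSR_aut S : (0 < m)%N -> ~~ is_mPGSR S ->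
  exists2 f, f \in graph_aut (mCay S) & forall h, f != rtrans h.
Proof.
move=> m_gt0 nS; suff /exists_inP[f fA /forallP] :
    [exists f in graph_aut (mCay S), [forall h, f != rtrans h]] by exists f.
apply: contraNT nS; rewrite negb_exists_in => /forall_inP autT.
apply: is_mPGSR_rtrans => // f /autT; rewrite negb_forall => /existsP[h].
by move/negPn/eqP; exists h.
Qed.

End SkewMatrices.

(** * Automorphisms preserve the partition *)

Section SecondMoment.
Variables (gT : finGroupType) (m : nat).
Implicit Type (S : 'M[{set gT}]_m) (i j : 'I_m) (s : gT) (x y z : gT * 'I_m).
Local Notation n := #|gT|.
Local Notation skew := (skew_matrices gT m).
Local Open Scope ring_scope.

Definition toggle_entry i j s S := upd_skew S i j (toggle s (S i j)).

Lemma toggle_entry_in i j s S : i != j -> S \in skew -> toggle_entry i j s S \in skew.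
Proof. exact: upd_skew_in. Qed.

Lemma toggle_entryK i j s S :
  i != j -> S \in skew -> toggle_entry i j s (toggle_entry i j s S) = S.
Proof. by move=> nij skS; rewrite /toggle_entry upd_skewE toggleK upd_skewK. Qed.

Definition toggled_arc i j s x y : bool := (x.2 == i) && (y == ((s * x.1)%g, j)).

Lemma mCay_toggle_entry i j s S x y : i != j -> S \in skew ->
  mCay (toggle_entry i j s S) x y =
  mCay S x y (+) (toggled_arc i j s x y || toggled_arc i j s y x).
Proof.
move=> nij /skewP[SV _]; rewrite !mCayE mxE /toggled_arc.
case: x y => [g a] [h b]; rewrite !xpair_eqE /=.
have eqM (u t : gT) : (t == (s * u)%g) = ((t * u^-1)%g == s).
  by rewrite -(inj_eq (mulIg u^-1%g)) mulgK.
have [->|_] := eqVneq a i; have [->|_] := eqVneq b j;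
  rewrite /= ?[j == i]eq_sym ?(negPf nij) ?andbF /= ?addbF //.
  by rewrite inE andbT orbF eqM.
have [->|_] := eqVneq a j; have [->|_] := eqVneq b i; rewrite /= ?andbF ?addbF //.
by rewrite (SV i j) !mem_invg invMg invgK inE andbT eqM.
Qed.

Lemma sum_sign_toggle_entry (h : 'M[{set gT}]_m -> bool) i j s : i != j ->
  {in skew, forall S, h (toggle_entry i j s S) = ~~ h S} ->
  \sum_(S in skew) (-1) ^+ h S = 0 :> int.
Proof.
move=> nij hN; pose U := \sum_(S in skew) ((-1) ^+ h S : int).
suff UN : U = - U by rewrite -/U; lia.
rewrite {1}/U (reindex_onto (toggle_entry i j s) (toggle_entry i j s)); last first.
  by move=> S; apply: toggle_entryK.
rewrite -sumrN (eq_bigl (fun S => S \in skew)) => [|S].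
  by apply: eq_bigr => S skS; rewrite hN // signrN.
apply/andP/idP => [[skS /eqP <-]|skS]; first exact: toggle_entry_in.
by rewrite toggle_entry_in ?toggle_entryK.
Qed.

Definition differ S x y z : bool := mCay S x z (+) mCay S y z.

Lemma differC S x y z : differ S x y z = differ S y x z.
Proof. exact: addbC. Qed.

Definition agreement S x y : int := \sum_z (-1) ^+ differ S x y z.

Definition noise S x y : int := agreement S x y - (n * (x.2 == y.2))%:Z.

Lemma noiseE S x y : S \in skew ->
  noise S x y = \sum_(z | ~~ ((z.2 == x.2) && (z.2 == y.2))) (-1) ^+ differ S x y z.
Proof.
move=> skS; rewrite /noise /agreement (bigID (fun z => (z.2 == x.2) && (z.2 == y.2))) /=.
rewrite addrAC [X in X - _](_ : _ = (n * (x.2 == y.2))%:Z) ?subrr ?add0r //.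
have [exy|nxy] := eqVneq x.2 y.2; last first.
  by rewrite muln0 big_pred0 // => z; apply: contraNF nxy => /andP[/eqP <-].
rewrite muln1 (eq_bigr (fun=> 1)) => [|z /andP[/eqP zx /eqP zy]]; last first.
  by rewrite /differ !mCay_same_part.
rewrite (eq_bigl (fun z => (z.1 \in gT) && (z.2 == x.2))); last first.
  by move=> z; rewrite -exy andbb.
rewrite -(pair_big (mem gT) (pred1 x.2) (fun _ _ => 1)) /=.
by under eq_bigr do rewrite big_pred1_eq; rewrite sumr_const natz.
Qed.

(* Toggling z.1 x.1^-1 in the entry (x.2, z.2) toggles the pair {x, z}; it
   affects no other pair among {x, z}, {y, z}, {x, z'}, {y, z'}, unless z' is
   one of these three vertices. *)
Definition correlated x y z : seq (gT * 'I_m) :=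
  let s := (z.1 * x.1^-1)%g in [:: z; ((s * y.1)%g, z.2); ((s^-1 * y.1)%g, x.2)].

Lemma sum_sign_uncorrelated x y z z' :
  x != y -> z.2 != x.2 -> z' \notin correlated x y z ->
  \sum_(S in skew) (-1) ^+ (differ S x y z (+) differ S x y z') = 0 :> int.
Proof.
move=> nxy nzx; rewrite !inE !negb_or => /and3P[nz'z nz'1 nz'2].
pose s := (z.1 * x.1^-1)%g; have nxz : x.2 != z.2 by rewrite eq_sym.
apply: (@sum_sign_toggle_entry _ x.2 z.2 s) => // S skS.
have z_def : z = ((s * x.1)%g, z.2) by rewrite mulgKV -surjective_pairing.
have arc_xz : toggled_arc x.2 z.2 s x z by rewrite /toggled_arc eqxx -z_def /=.
have arc_yz : toggled_arc x.2 z.2 s y z = false.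
  apply: contraNF nxy => /andP[/eqP ey /eqP]; rewrite z_def => -[/mulgI ex].
  by rewrite [x]surjective_pairing [y]surjective_pairing ex ey.
have arc_xz' : toggled_arc x.2 z.2 s x z' = false.
  by rewrite /toggled_arc -z_def (negPf nz'z) andbF.
have arc_yz' : toggled_arc x.2 z.2 s y z' = false.
  by rewrite /toggled_arc (negPf nz'1) andbF.
have arc_z u : toggled_arc x.2 z.2 s z u = false by rewrite /toggled_arc (negPf nzx).
have arc_z'x : toggled_arc x.2 z.2 s z' x = false.
  by rewrite /toggled_arc -pair_eqE /pair_eq (negPf nxz) !andbF.
have arc_z'y : toggled_arc x.2 z.2 s z' y = false.
  apply: contraNF nz'2 => /andP[/eqP ez' /eqP ->] /=.
  by rewrite mulKg -ez' -surjective_pairing.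
rewrite /differ !mCay_toggle_entry // arc_xz arc_yz arc_xz' arc_yz' !arc_z.
by rewrite arc_z'x arc_z'y !addbF addbT !addNb.
Qed.

Lemma sum_sign_differ_le (P : pred (gT * 'I_m)) x y z : x != y -> z.2 != x.2 ->
  \sum_(z' | P z') \sum_(S in skew) (-1) ^+ (differ S x y z (+) differ S x y z')
  <= (3 * #|skew|)%:Z :> int.
Proof.
move=> nxy nzx; apply: (@le_trans _ _ (\sum_(z' in correlated x y z) #|skew|%:Z)).
  rewrite big_mkcond [leRHS]big_mkcond; apply: ler_sum => z' _.
  have [corr|ncorr] := boolP (z' \in correlated x y z); last first.
    by rewrite sum_sign_uncorrelated ?if_same.
  case: ifP => // _; rewrite -natz -sumr_const.
  by apply: ler_sum => S _; case: (_ (+) _).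
rewrite sumr_const -mulr_natl natz -PoszM lez_nat leq_mul2r; apply/orP; right.
exact: card_size.
Qed.

Lemma second_moment x y : x != y ->
  (\sum_(S in skew) `|noise S x y| ^ 2 <= 3 * (n * m) * #|skew|)%N.
Proof.
move=> nxy; rewrite -lez_nat (big_morph Posz (id1 := 0) PoszD) //.
pose P z := ~~ ((z.2 == x.2) && (z.2 == y.2)).
have -> : \sum_(S in skew) (`|noise S x y| ^ 2)%:Z =
    \sum_(z | P z) \sum_(z' | P z') \sum_(S in skew)
      ((-1) ^+ (differ S x y z (+) differ S x y z') : int).
  under eq_bigr => S skS.
    by rewrite -abszX gez0_abs ?sqr_ge0 // noiseE // expr2 big_distrlr /=; over.
  rewrite exchange_big; apply: eq_bigr => z _.
  rewrite exchange_big; apply: eq_bigr => z' _.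
  by apply: eq_bigr => S _; rewrite -signr_addb.
apply: (@le_trans _ _ (\sum_(z | P z) (3 * #|skew|)%:Z)).
  apply: ler_sum => z; rewrite /P negb_and => /orP[nzx|nzy].
    exact: sum_sign_differ_le.
  under eq_bigr => z' _ do
    under eq_bigr => S _ do rewrite differC [differ S x y z']differC.
  by apply: sum_sign_differ_le; rewrite // eq_sym.
rewrite sumr_const -mulr_natr natz -PoszM lez_nat [leqRHS]mulnAC leq_mul2l.
by rewrite -card_vertex max_card orbT.
Qed.

Definition deviating S x : {set gT * 'I_m} :=
  [set y | (y != x) && (n <= 2 * `|noise S x y|)%N].

Lemma sum_deviating x : (\sum_(S in skew) #|deviating S x| <= 12 * m ^ 2 * #|skew|)%N.
Proof.
have n_gt0 : (0 < n)%N by rewrite -cardsT cardG_gt0.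
have chebyshev S :
    (#|deviating S x| * n ^ 2 <= \sum_(y | y != x) 4 * `|noise S x y| ^ 2)%N.
  pose sq_noise y := (4 * `|noise S x y| ^ 2)%N.
  apply: leq_trans (markov_card [pred y | y != x] sq_noise (n ^ 2)).
  rewrite leq_mul2r; apply/orP; right.
  apply/subset_leq_card/subsetP => y; rewrite !inE => /andP[-> /=].
  by rewrite -(leq_exp2r _ _ (isT : 0 < 2)%N) expnMn.
rewrite -(leq_pmul2r (_ : 0 < n ^ 2)%N) ?expn_gt0 ?n_gt0 // big_distrl /=.
apply: leq_trans (_ : _ <= \sum_(S in skew) \sum_(y | y != x) _)%N _.
  by apply: leq_sum => S _; apply: chebyshev.
rewrite exchange_big /=.
apply: (@leq_trans (\sum_(y : gT * 'I_m) 4 * (3 * (n * m) * #|skew|))).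
  rewrite big_mkcond; apply: leq_sum => y _; case: ifP => // nyx.
  by rewrite -big_distrr leq_mul2l /= second_moment // eq_sym.
by rewrite sum_nat_const card_vertex; apply: eq_leq; ring.
Qed.

Lemma agreement_aut S (f : {perm gT * 'I_m}) x y :
  f \in graph_aut (mCay S) -> agreement S (f x) (f y) = agreement S x y.
Proof.
move=> /graph_autP fA; rewrite /agreement (reindex_inj (@perm_inj _ f)) /=.
by apply: eq_bigr => z _; rewrite /differ !fA.
Qed.

Lemma deviating_rtrans S x h : #|deviating S (rtrans m h x)| = #|deviating S x|.
Proof.
rewrite -[RHS](card_imset _ (@perm_inj _ (rtrans m h))); apply: eq_card => y.
rewrite -(permKV (rtrans m h) y) (mem_imset _ _ (@perm_inj _ _)).
by rewrite !inE (inj_eq perm_inj) /noise agreement_aut ?rtrans_aut // !rtransE.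
Qed.

Definition rough_at x : {set 'M[{set gT}]_m} :=
  [set S in skew | (n <= 4 * #|deviating S x|)%N].

Definition rough_matrices : {set 'M[{set gT}]_m} := \bigcup_i rough_at (1%g, i).

Lemma card_rough_at x : (#|rough_at x| * n <= 48 * m ^ 2 * #|skew|)%N.
Proof.
apply: leq_trans (markov_card (mem skew) (fun S => 4 * #|deviating S x|)%N n) _.
have -> : (48 * m ^ 2 * #|skew| = 4 * (12 * m ^ 2 * #|skew|))%N by rewrite !mulnA.
by rewrite -big_distrr leq_mul2l sum_deviating.
Qed.

Lemma card_rough : (#|rough_matrices| * n <= 48 * m ^ 3 * #|skew|)%N.
Proof.
have := union_bound (subxx rough_matrices) (fun i _ => card_rough_at (1%g, i)).
by rewrite card_ord mulnA mulnCA -expnS.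
Qed.

Lemma card_deviating_smooth S x :
  S \in skew -> S \notin rough_matrices -> (4 * #|deviating S x| < n)%N.
Proof.
move=> skS; apply: contraR; rewrite -leqNgt => rough.
apply/bigcupP; exists x.2 => //; rewrite inE skS -(deviating_rtrans _ _ x.1).
by rewrite rtransE mul1g -surjective_pairing.
Qed.

Definition agreeing S x y : bool := n%:Z < 2 * agreement S x y.

Lemma agreeingE S x y : y \notin deviating S x -> agreeing S x y = (x.2 == y.2).
Proof.
have n_gt0 : (0 < n)%N by rewrite -cardsT cardG_gt0.
rewrite inE negb_and negbK -ltnNge /agreeing /noise => /orP[/eqP->|].
  rewrite eqxx /agreement (eq_bigr (fun=> 1)) => [|z _]; last by rewrite /differ addbb.
  have : (n <= n * m)%N by rewrite leq_pmulr // (leq_ltn_trans _ (ltn_ord x.2)).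
  by rewrite sumr_const card_vertex !natz; lia.
by case: (x.2 == y.2); lia.
Qed.

Lemma aut_same_part S (f : {perm gT * 'I_m}) x y :
  S \in skew -> S \notin rough_matrices -> f \in graph_aut (mCay S) ->
  x.2 = y.2 -> (f x).2 = (f y).2.
Proof.
move=> skS /(card_deviating_smooth _ skS) small fA exy.
pose bad := deviating S x :|: deviating S y
  :|: f @^-1: deviating S (f x) :|: f @^-1: deviating S (f y).
have lt_bad : (#|bad| < n)%N.
  have small_preim u : (4 * #|f @^-1: deviating S (f u)| < n)%N.
    by rewrite card_preimset ?small //; apply: perm_inj.
  apply: leq_ltn_trans (leq_card_setU4 _ _ _ _) _.
  by have := small x; have := small y; have := small_preim x; have := small_preim y; lia.
have /subsetPn[z /imsetP[g _ z_def]] : ~~ ([set (g, x.2) | g : gT] \subset bad).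
  by apply: contraL lt_bad => /subset_leq_card; rewrite card_imset -?leqNgt // => g h [].
have agreeing_f u : agreeing S (f u) (f z) = agreeing S u z.
  by rewrite /agreeing agreement_aut.
rewrite !in_setU !negb_or ![z \in f @^-1: _]in_set -!andbA => /and4P[].
move=> /agreeingE zx /agreeingE zy /agreeingE zfx /agreeingE zfy.
move: zfx zfy; rewrite !agreeing_f zx zy -exy z_def eqxx.
by move=> /esym/eqP-> /esym/eqP->.
Qed.

End SecondMoment.

(** * Automorphisms and a resolving base *)

Lemma group_gt_half (gT : finGroupType) (H : {group gT}) :
  (#|gT| < 2 * #|H|)%N -> H = [set: gT] :> {set gT}.
Proof.
rewrite -cardsT -(Lagrange (subsetT H)) mulnC ltn_pmul2r // ltnS.
by rewrite leqNgt indexg_gt1 negbK subTset => /eqP.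
Qed.

Section Intertwiners.
Variable gT : finGroupType.
Implicit Types (f : gT -> gT) (s t g h : gT).

Definition intertwiners f1 f2 : {set gT} :=
  [set s | [forall g, f2 (s * g) == s * f1 g]].

Lemma intertwinersP f1 f2 s :
  reflect (forall g, f2 (s * g) = s * f1 g) (s \in intertwiners f1 f2).
Proof. by rewrite inE; apply: 'forall_eqP. Qed.

Lemma intertwiners_group_set f : group_set (intertwiners f f).
Proof.
apply/group_setP; split=> [|s t /intertwinersP fs /intertwinersP ft].
  by apply/intertwinersP => g; rewrite !mul1g.
by apply/intertwinersP => g; rewrite -!mulgA fs ft.
Qed.
Canonical intertwiners_group f := Group (intertwiners_group_set f).

Lemma intertwiners_rcoset f1 f2 t :
  t \in intertwiners f1 f2 -> intertwiners f1 f2 = intertwiners f2 f2 :* t.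
Proof.
move=> /intertwinersP f12t; apply/setP => s; rewrite mem_rcoset.
apply/intertwinersP/intertwinersP => fs g.
  by rewrite -mulgA fs -mulgA; congr (_ * _); apply: (mulgI t); rewrite -f12t !mulKVg.
by rewrite -{1}[s](mulgKV t) -mulgA fs f12t mulgA mulgKV.
Qed.

Lemma intertwiners_gt_half f1 f2 : (#|gT| < 2 * #|intertwiners f1 f2|)%N ->
  exists h, (forall g, f1 g = g * h) /\ (forall g, f2 g = g * h).
Proof.
move=> gt_half.
have /card_gt0P[t f12t] : (0 < #|intertwiners f1 f2|)%N by case: #|_| gt_half.
move: gt_half; rewrite (intertwiners_rcoset f12t) card_rcoset => /group_gt_half fullT.
have f2E g : f2 g = g * f2 1.
  have /intertwinersP/(_ 1) : g \in intertwiners f2 f2 by rewrite fullT inE.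
  by rewrite mulg1.
exists (f2 1); split=> // g; apply: (mulgI t).
by rewrite -(intertwinersP _ _ _ f12t) f2E mulgA.
Qed.

End Intertwiners.

Section Base.
Variables (gT : finGroupType) (m k : nat) (v : 'I_k -> gT).
Implicit Type (S : 'M[{set gT}]_m) (a b i j : 'I_m) (f : {perm gT * 'I_m}).
Implicit Type (w : {ffun 'I_k -> gT * 'I_m}) (z : gT * 'I_m).
Local Notation n := #|gT|.
Local Notation skew := (skew_matrices gT m).

Definition signature S b j g : {ffun 'I_k -> bool} :=
  [ffun l => mCay S (v l, b) (g, j)].

Definition resolving S : bool :=
  [forall b, forall j, (b != j) ==> injectiveb (signature S b j)].

Lemma resolving_inj S b j g h : resolving S -> b != j ->
  (forall l, mCay S (v l, b) (g, j) = mCay S (v l, b) (h, j)) -> g = h.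
Proof.
move=> /forallP/(_ b)/forallP/(_ j)/implyP resS /resS/injectiveP inj_sig eq_sig.
by apply: inj_sig; apply/ffunP => l; rewrite !ffunE.
Qed.

Definition twinned b j g h : {set 'M[{set gT}]_m} :=
  [set S in skew | signature S b j g == signature S b j h].

Lemma card_twinned b j g h : injective v -> b != j -> g != h ->
  (#|twinned b j g h| * 2 ^ uphalf k <= #|skew|)%N.
Proof.
move=> inj_v nbj ngh; apply: (leq_card_fibers nbj) => [|S skS].
  by apply/subsetP => S /setIdP[].
pose M := [set g * (v l)^-1 | l : 'I_k].
have <- : #|M| = k by rewrite card_imset ?card_ord // => l l' /mulgI/invg_inj/inj_v.
apply: card_inseparable => _ /imsetP[l _ ->]; exists (h * (v l)^-1).
  by rewrite (inj_eq (mulIg _)) eq_sym.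
apply/forall_inP => A; rewrite in_set => /setIdP[_ /eqP/ffunP/(_ l)].
by rewrite !ffunE !mCayE upd_skewE => ->.
Qed.

Definition unresolved_matrices : {set 'M[{set gT}]_m} := [set S in skew | ~~ resolving S].

Lemma card_unresolved : injective v ->
  (#|unresolved_matrices| * 2 ^ uphalf k <= m ^ 2 * n ^ 2 * #|skew|)%N.
Proof.
move=> inj_v; rewrite (_ : m ^ 2 * n ^ 2 = #|{: 'I_m * 'I_m * (gT * gT)}|)%N; last first.
  by rewrite !card_prod !card_ord -!mulnn.
pose F (d : 'I_m * 'I_m * (gT * gT)) := twinned d.1.1 d.1.2 d.2.1 d.2.2.
pose P (d : 'I_m * 'I_m * (gT * gT)) := (d.1.1 != d.1.2) && (d.2.1 != d.2.2).
apply: (union_bound (P := P) (F := F)) => [|d /andP[nbj ngh]]; last exact: card_twinned.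
apply/subsetP => S /setIdP[skS /forallPn[b /forallPn[j]]].
rewrite negb_imply => /andP[nbj /injectivePn[g [h ngh eq_sig]]].
apply/bigcupP; exists (b, j, (g, h)); first by rewrite /P nbj.
by rewrite in_set skS eq_sig eqxx.
Qed.

Definition part_map f j g : gT := (f (g, j)).1.

Lemma part_mapE f j a g : (f (g, j)).2 = a -> f (g, j) = (part_map f j g, a).
Proof. by move=> <-; apply: surjective_pairing. Qed.

(* Only edges that meet the part b are used, and S and S' share these. *)
Lemma resolving_aut_eq S S' f f' b j a :
  S \in skew -> S' \in skew -> S b =1 S' b -> resolving S -> b != j ->
  f \in graph_aut (mCay S) -> f' \in graph_aut (mCay S') ->
  (forall l, f' (v l, b) = f (v l, b)) ->
  (forall g, (f (g, j)).2 = a) -> (forall g, (f' (g, j)).2 = a) ->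
  a = b \/ (forall l, (f (v l, b)).2 = b) ->
  forall g, f' (g, j) = f (g, j).
Proof.
move=> skS skS' eqSb resS nbj /graph_autP fA /graph_autP fA' eq_base fj f'j touch_b g.
have inj_f : injective (part_map f j).
  move=> h h' eq_h; have /perm_inj[] // : f (h, j) = f (h', j).
  by rewrite !(part_mapE (fj _)) eq_h.
have /codomP[h fh] := injF_onto inj_f (part_map f' j g).
have f'gE : f' (g, j) = f (h, j) by rewrite (part_mapE (fj h)) (part_mapE (f'j g)) fh.
rewrite f'gE; congr (f (_, j)); apply: (resolving_inj resS nbj) => l.
rewrite -fA -f'gE (mCay_eq_row skS skS' eqSb); last first.
  by case: touch_b => [<-|->]; rewrite ?f'j eqxx ?orbT.
by rewrite -eq_base fA' -(mCay_eq_row skS skS' eqSb) ?eqxx.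
Qed.

Definition part_moving_at b i j w z : {set 'M[{set gT}]_m} :=
  [set S in skew | resolving S &&
    [exists f in graph_aut (mCay S), [&& [forall l, f (v l, b) == w l],
      f (1, i) == z & [forall g, (f (g, j)).2 == b]]]].

(* The edges that meet the part b determine f on the part j, and f carries the
   pair of parts (i, j) to a pair that contains b, hence the entry (i, j) is a
   function of the row b and of w and z. *)
Lemma card_part_moving_at b i j w z : b != i -> b != j -> i != j ->
  (#|part_moving_at b i j w z| * 2 ^ n <= #|skew|)%N.
Proof.
move=> nbi nbj nij; apply: (leq_card_fibers nij) => [|S skS].
  by apply/subsetP => S /setIdP[].
rewrite -[leqRHS]mul1n leq_mul2r; apply/orP; right; apply/card_le1_eqP => A A'.
rewrite in_set => /setIdP[skA /andP[resA /exists_inP[f fA /and3P[]]]].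
move=> /'forall_eqP fw /eqP fz /'forall_eqP fj.
rewrite in_set => /setIdP[skA' /andP[resA' /exists_inP[f' fA' /and3P[]]]].
move=> /'forall_eqP fw' /eqP fz' /'forall_eqP fj'.
have eq_row : upd_skew S i j A b =1 upd_skew S i j A' b.
  by move=> l; rewrite !upd_skew_row.
have eq_f g : f' (g, j) = f (g, j).
  apply: (resolving_aut_eq (a := b) skA skA' eq_row resA nbj fA fA') => // [l|].
    by rewrite fw fw'.
  by left.
have mem_edge (B : {set gT}) s : s \in B = mCay (upd_skew S i j B) (1, i) (s, j).
  by rewrite mCayE upd_skewE invg1 mulg1.
apply/setP => s; rewrite !mem_edge -(graph_autP _ _ fA) -(graph_autP _ _ fA') eq_f fz fz'.
by rewrite (mCay_eq_row skA skA' eq_row) ?fj ?eqxx ?orbT.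
Qed.

Definition part_moving_matrices : {set 'M[{set gT}]_m} :=
  [set S in skew | resolving S && [exists f in graph_aut (mCay S),
    [exists b, exists j, (b != j) && [forall g, (f (g, j)).2 == b]]]].

Lemma card_part_moving : (3 <= m)%N ->
  (#|part_moving_matrices| * 2 ^ n <= m ^ 3 * (n * m) ^ k.+1 * #|skew|)%N.
Proof.
move=> m_ge3.
pose D := ('I_m * 'I_m * 'I_m * {ffun 'I_k -> gT * 'I_m} * (gT * 'I_m))%type.
have <- : (#|{: D}| = m ^ 3 * (n * m) ^ k.+1)%N.
  rewrite card_prod card_vertex !card_prod card_ffun card_vertex !card_ord.
  by rewrite [RHS]mulnC expnSr; ring.
pose F (d : D) := let: (b, i, j, w, z) := d in part_moving_at b i j w z.
pose P (d : D) := let: (b, i, j, w, z) := d in [&& b != i, b != j & i != j].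
apply: (union_bound (P := P) (F := F)) => [|[[[[b i] j] w] z] /and3P[]]; last first.
  exact: card_part_moving_at.
apply/subsetP => S /setIdP[skS /andP[resS /exists_inP[f fA /existsP[b /existsP[j]]]]].
move=> /andP[nbj fj]; have [i nib nij] : exists2 i, i != b & i != j.
  by apply: exists_neq2; rewrite card_ord.
apply/bigcupP; exists (b, i, j, [ffun l => f (v l, b)], f (1, i)).
  by rewrite /P eq_sym nib nbj.
rewrite in_set skS resS; apply/exists_inP; exists f => //.
by apply/and3P; split=> //; apply/'forall_eqP => l; rewrite ffunE.
Qed.

Lemma resolving_aut_rtrans S f p h : resolving S -> f \in graph_aut (mCay S) ->
  (forall x, (f x).2 = x.2) -> (forall g, f (g, p) = (g * h, p)) -> f = rtrans m h.
Proof.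
move=> resS fA fparts fp; apply/permP => -[g j]; rewrite rtransE /=.
have [->|njp] := eqVneq j p; first exact: fp.
pose f' := f * (rtrans m h)^-1.
have /graph_autP fA' : f' \in graph_aut (mCay S) by rewrite groupM ?groupV ?rtrans_aut.
have f'E x : f' x = ((f x).1 * h^-1, x.2).
  rewrite permM; apply: (canLR (permK _)).
  by rewrite rtransE /= mulgKV -fparts -surjective_pairing.
suff f'_fix : (f' (g, j)).1 = g.
  by rewrite -{2}f'_fix f'E mulgKV [LHS]surjective_pairing fparts.
apply: (resolving_inj resS (_ : p != j)) => [|l]; first by rewrite eq_sym.
by rewrite -[RHS]fA' !f'E fp mulgK.
Qed.

Lemma mem_entry_part_map S f i j s g : f \in graph_aut (mCay S) ->
  (forall x, (f x).2 = x.2) ->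
  (s \in S i j) = (part_map f j (s * g) * (part_map f i g)^-1 \in S i j).
Proof.
move=> /graph_autP/(_ (g, i) (s * g, j)) + fparts.
by rewrite !(part_mapE (fparts _)) !mCayE mulgK => ->.
Qed.

Lemma card_intertwiners_part_map S f i j : resolving S -> f \in graph_aut (mCay S) ->
  (forall x, (f x).2 = x.2) -> (forall h, f != rtrans m h) ->
  (2 * #|intertwiners (part_map f i) (part_map f j)| <= n)%N.
Proof.
move=> resS fA fparts fntrans; rewrite leqNgt.
apply/negP => /intertwiners_gt_half[h [fih _]].
case/negP: (fntrans h); apply/eqP/(resolving_aut_rtrans resS fA fparts (p := i)) => g.
by rewrite (part_mapE (fparts _)) fih.
Qed.

Definition untranslated_at b w : {set 'M[{set gT}]_m} :=
  [set S in skew | resolving S &&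
    [exists f in graph_aut (mCay S), [&& [forall l, f (v l, b) == w l],
      [forall x, (f x).2 == x.2] & [forall h, f != rtrans m h]]]].

Lemma card_untranslated_at b i j w : b != i -> b != j -> i != j ->
  (#|untranslated_at b w| * 2 ^ (n %/ 4) <= #|skew|)%N.
Proof.
move=> nbi nbj nij; apply: (leq_card_fibers nij) => [|S skS].
  by apply/subsetP => S /setIdP[].
set X := [set A | _]; have [->|/set0Pn[A0]] := eqVneq X set0; first by rewrite cards0.
rewrite in_set => /setIdP[skA0 /andP[resA0 /exists_inP[f fA0 /and3P[]]]].
move=> /'forall_eqP fw /'forall_eqP fparts /forallP fntrans.
pose fi := part_map f i; pose fj := part_map f j.
have identified A s g : A \in X -> (s \in A) = (fj (s * g) * (fi g)^-1 \in A).
  rewrite in_set => /setIdP[skA /andP[resA /exists_inP[f' fA /and3P[]]]].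
  move=> /'forall_eqP fw' /'forall_eqP fparts' _.
  have eq_row : upd_skew S i j A0 b =1 upd_skew S i j A b.
    by move=> l; rewrite !upd_skew_row.
  have eq_f c : b != c -> forall h, f' (h, c) = f (h, c).
    move=> nbc; apply: (resolving_aut_eq (a := c) skA0 skA eq_row resA0 nbc fA0 fA) => //.
    + by move=> l; rewrite fw fw'.
    + by right.
  have := mem_entry_part_map i j s g fA fparts'.
  by rewrite upd_skewE /part_map !eq_f.
have partner s : s \in ~: intertwiners fi fj -> exists2 t, t != s & inseparable X s t.
  rewrite !inE => /forallPn[g ng]; exists (fj (s * g) * (fi g)^-1).
    by apply: contraNneq ng => eq_s; rewrite -{2}eq_s mulgKV.
  by apply/forall_inP => A XA; rewrite -identified.
apply: leq_trans (card_inseparable partner); rewrite leq_mul2l leq_pexp2l ?orbT //.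
have := card_intertwiners_part_map i j resA0 fA0 fparts fntrans.
by rewrite -/fi -/fj -(cardsC (intertwiners fi fj)); lia.
Qed.

Definition untranslated_matrices : {set 'M[{set gT}]_m} :=
  [set S in skew | resolving S && [exists f in graph_aut (mCay S),
    [forall x, (f x).2 == x.2] && [forall h, f != rtrans m h]]].

Lemma card_untranslated : (3 <= m)%N ->
  (#|untranslated_matrices| * 2 ^ (n %/ 4) <= (n * m) ^ k * #|skew|)%N.
Proof.
rewrite -{1}(card_ord m) => /card_gt2P[b [i [j [_ [nbi nij njb]]]]].
rewrite (_ : (n * m) ^ k = #|{ffun 'I_k -> gT * 'I_m}|)%N; last first.
  by rewrite card_ffun card_vertex card_ord.
apply: (union_bound (P := predT) (F := untranslated_at b)) => [|w _]; last first.
  by apply: card_untranslated_at nbi _ nij; rewrite eq_sym.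
apply/subsetP => S /setIdP[skS /andP[resS /exists_inP[f fA fS]]].
apply/bigcupP; exists [ffun l => f (v l, b)] => //.
rewrite in_set skS resS; apply/exists_inP; exists f => //.
by rewrite fS andbT; apply/'forall_eqP => l; rewrite ffunE.
Qed.

Lemma not_mPGSR_subset : (0 < m)%N ->
  skew :\: mPGSR_matrices gT m \subset
    rough_matrices gT m :|: unresolved_matrices :|: part_moving_matrices
    :|: untranslated_matrices.
Proof.
move=> m_gt0; apply/subsetP => S /setDP[skS]; rewrite inE skS !in_setU /= => nS.
have [//|/(aut_same_part skS) same_part] := boolP (S \in rough_matrices gT m).
rewrite [S \in unresolved_matrices]inE skS /=; have [resS /=|//] := boolP (resolving S).
have [f fA fntrans] := not_mPGSR_aut m_gt0 nS.
have [fparts|/forallPn[[g j] /= nfj]] := boolP [forall x, (f x).2 == x.2].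
  apply/orP; right; rewrite inE skS resS; apply/exists_inP; exists f => //.
  by rewrite fparts; apply/forallP.
apply/orP; left; rewrite inE skS resS; apply/exists_inP; exists f => //.
apply/existsP; exists (f (g, j)).2; apply/existsP; exists j; rewrite nfj.
by apply/'forall_eqP => h; apply: same_part.
Qed.

End Base.

(** * The proportion of exceptional set-matrices *)

Section ExceptionalProportion.
Local Open Scope nat_scope.

Lemma quadratic_leq_exp2 L : 16 <= L -> 48 * L ^ 2 + 24 * L <= 2 ^ L.-1.
Proof.
move=> /subnK <-; elim: (L - 16) => [|d IHd]; first by rewrite !expnS !expn0; lia.
have -> : (d.+1 + 16).-1 = (d + 16).-1.+1 by lia.
by rewrite [leqRHS]expnS; move: IHd; rewrite -!mulnn; move: (2 ^ _) => E; nia.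
Qed.

Lemma exists_base_size n m : m <= n -> 2 ^ 16 <= n ->
  exists k, [/\ k <= n, n ^ 3 <= 2 ^ uphalf k &
                m ^ 3 * (n * m) ^ k.+1 * n <= 2 ^ (n %/ 4)].
Proof.
move=> le_mn le_n; pose L := up_log 2 n; exists (6 * L).
have n_gt1 : 1 < n by apply: leq_trans le_n.
have /andP[lt_Ln le_nL] := up_log_bounds (isT : 1 < 2) n_gt1.
have le_L : 16 <= L by rewrite -(leq_exp2l _ _ (isT : 1 < 2)); apply: leq_trans le_nL.
have le_Ln := leq_trans (quadratic_leq_exp2 le_L) (ltnW lt_Ln).
split; first by lia.
  have -> : uphalf (6 * L) = L * 3 by lia.
  by rewrite expnM leq_exp2r.
have le_Lq : 12 * L ^ 2 + 6 * L <= n %/ 4 by rewrite leq_divRL //; lia.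
apply: leq_trans (leq_pexp2l (isT : 0 < 2) le_Lq).
have -> : 12 * L ^ 2 + 6 * L = L * 3 + (L + L) * (6 * L).+1 + L by rewrite -mulnn; lia.
have le_mL := leq_trans le_mn le_nL.
by rewrite !expnD 2!expnM !leq_mul // ?leq_exp2r // expnD leq_mul.
Qed.

Lemma card_not_mPGSR (gT : finGroupType) (m : nat) :
  3 <= m -> m <= #|gT| -> 2 ^ 16 <= #|gT| ->
  #|skew_matrices gT m :\: mPGSR_matrices gT m| * #|gT|
  <= 50 * m ^ 3 * #|skew_matrices gT m|.
Proof.
set n := #|gT| => m_ge3 le_mn le_n; have m_gt0 : 0 < m := ltnW (ltnW m_ge3).
have n_gt0 : 0 < n by apply: leq_trans le_n.
have [k [le_kn le_n3k le_q]] := exists_base_size le_mn le_n.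
have [v inj_v] : exists v : 'I_k -> gT, injective v.
  exists (fun l => enum_val (widen_ord le_kn l)) => l l' /enum_val_inj/(congr1 val) eq_l.
  exact: val_inj.
have rough := card_rough gT m.
have unresolved : #|unresolved_matrices m v| * n <= m ^ 2 * #|skew_matrices gT m|.
  apply: leq_ratio_trans (card_unresolved m inj_v) _; first by rewrite expn_gt0.
  by rewrite -mulnA -expnSr leq_mul2l le_n3k orbT.
have moving : #|part_moving_matrices m v| * n <= 1 * #|skew_matrices gT m|.
  apply: leq_ratio_trans (card_part_moving v m_ge3) _; first by rewrite expn_gt0.
  by rewrite mul1n (leq_trans le_q) // leq_pexp2l // leq_div.
have untranslated : #|untranslated_matrices m v| * n <= 1 * #|skew_matrices gT m|.
  apply: leq_ratio_trans (card_untranslated v m_ge3) _; first by rewrite expn_gt0.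
  rewrite mul1n; apply: leq_trans le_q; rewrite leq_mul2r; apply/orP; right.
  rewrite [(n * m) ^ _.+1]expnS mulnA leq_pmull //.
  by rewrite muln_gt0 expn_gt0 muln_gt0 m_gt0 n_gt0.
have covered := subset_leq_card (not_mPGSR_subset v m_gt0).
have le_sum4 := leq_trans covered (leq_card_setU4 _ _ _ _).
apply: leq_trans (leq_mul le_sum4 (leqnn n)) _; rewrite !mulnDl.
have le_m23 : m ^ 2 + 2 <= 2 * m ^ 3 by rewrite !expnS expn0; nia.
apply: leq_trans (leq_add (leq_add (leq_add rough unresolved) moving) untranslated) _.
by rewrite -!mulnDl leq_mul2r; apply/orP; right; lia.
Qed.

End ExceptionalProportion.

Local Open Scope ring_scope.

Lemma mPGSR_proportionE (R : rcfType) (gT : finGroupType) (m : nat) :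
  mPGSR_proportion R gT m =
  1 - #|skew_matrices gT m :\: mPGSR_matrices gT m|%:R / #|skew_matrices gT m|%:R.
Proof.
have sub : mPGSR_matrices gT m \subset skew_matrices gT m.
  by apply/subsetP => S /setIdP[].
rewrite /mPGSR_proportion cardsDS // natrB ?subset_leq_card // mulrBl divff ?subKr //.
by rewrite pnatr_eq0 -lt0n card_skew_gt0.
Qed.

Lemma ltr_div_sqrt (R : rcfType) (a b c d x : R) : 0 < b -> 0 < c -> 0 <= d ->
  d < Num.sqrt x -> a * x <= c * d * b -> a / b < c / Num.sqrt x.
Proof.
move=> b_gt0 c_gt0 d_ge0 lt_dx le_ax.
have s_gt0 : 0 < Num.sqrt x := le_lt_trans d_ge0 lt_dx.
have x_gt0 : 0 < x by rewrite -sqrtr_gt0.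
rewrite ltr_pdivrMr // mulrAC ltr_pdivlMr // -(ltr_pM2r s_gt0).
rewrite -mulrA -expr2 sqr_sqrtr ?ltW //; apply: le_lt_trans le_ax _.
by rewrite mulrAC ltr_pM2l // mulr_gt0.
Qed.

Theorem theorem1p8 (m : nat) (hm : (3 <= m)%N) :
  exists N : nat, forall (R : rcfType) (gT : finGroupType), (N <= #|gT|)%N ->
    1 - m%:R ^+ 2 / Num.sqrt #|gT|%:R < mPGSR_proportion R gT m.
Proof.
exists (maxn (2 ^ 16) ((51 * m) ^ 2)) => R gT; rewrite geq_max => /andP[le16 le_m2].
have m_gt0 : (0 < m)%N by apply: leq_trans hm.
have le_mn : (m <= #|gT|)%N by apply: leq_trans le_m2; rewrite -mulnn; nia.
rewrite mPGSR_proportionE ltrD2l ltrN2; apply: (@ltr_div_sqrt _ _ _ _ (50 * m)%:R) => //.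
- by rewrite ltr0n card_skew_gt0.
- by rewrite exprn_gt0 ?ltr0n.
- apply: (@lt_le_trans _ _ (51 * m)%:R); first by rewrite ltr_nat ltn_pmul2r.
  by rewrite -[leLHS]ger0_norm // -sqrtr_sqr ler_wsqrtr // -natrX ler_nat.
rewrite -natrX -!natrM ler_nat; apply: leq_trans (card_not_mPGSR hm le_mn le16) _.
by apply: eq_leq; ring.
Qed.
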